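(* Let $0<q,t<1$, $m\ge1$, $1\le k\le m$. Let $\vec{\mathsf{x}},\vec{\mathsf{y}},\vec{\mathsf{z}},\vec{\mathsf{w}}\in\mathbb{W}_m$ be such that $\mathsf{y}_i-\mathsf{x}_i\in\{-1,0\}$, $\mathsf{z}_i-\mathsf{y}_i\in\{-1,0\}$, $\mathsf{w}_i-\mathsf{x}_i\in\{-1,0\}$, $\mathsf{z}_i-\mathsf{w}_i\in\{-1,0\}$ for all $1\le i\le m$, and $\mathsf{w}_i=\mathsf{y}_i$ for $i\ne k$, $\mathsf{w}_k=\mathsf{y}_k-1$ (so that $\mathsf{y}_k=\mathsf{x}_k$ and $\mathsf{z}_k=\mathsf{w}_k=\mathsf{y}_k-1$). Then $$\frac{\Upsilon_m(\vec{\mathsf{x}},\vec{\mathsf{y}})\,\Upsilon_m(\vec{\mathsf{y}},\vec{\mathsf{z}})}{\Upsilon_m(\vec{\mathsf{x}},\vec{\mathsf{w}})\,\Upsilon_m(\vec{\mathsf{w}},\vec{\mathsf{z}})}=t\prod_{i=1}^{k-1}\frac{\mathbf{1}_{\mathsf{z}_i=\mathsf{y}_i-1}+\omega(\mathsf{y}_i-\mathsf{y}_k,k-i)\mathbf{1}_{\mathsf{z}_i=\mathsf{y}_i}}{\mathbf{1}_{\mathsf{y}_i=\mathsf{x}_i-1}+\omega(\mathsf{x}_i-\mathsf{x}_k,k-i)\mathbf{1}_{\mathsf{y}_i=\mathsf{x}_i}}\prod_{j=k+1}^{m}\frac{\mathbf{1}_{\mathsf{y}_j=\mathsf{x}_j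}+\omega(\mathsf{x}_k-\mathsf{x}_j,j-k)\mathbf{1}_{\mathsf{y}_j=\mathsf{x}_j-1}}{\mathbf{1}_{\mathsf{z}_j=\mathsf{y}_j}+\omega(\mathsf{y}_k-\mathsf{y}_j-1,j-k)\mathbf{1}_{\mathsf{z}_j=\mathsf{y}_j-1}}.$$
   Context: $\mathbb{W}_m$ is the set of integer vectors $\vec{\mathsf{x}}=(\mathsf{x}_1>\dots>\mathsf{x}_m\ge0)$; $\mathbf{1}_A$ is the indicator of $A$. Define $$\omega(a,b)=\frac{(1-t^{a-b+1}q^{b-1})(1-t^{a-b}q^{b+1})}{(1-t^{a-b+1}q^{b})(1-t^{a-b}q^{b})}.$$ For $|p|<1$, $(z;p)_\infty=\prod_{i\ge 0}(1-zp^i)$, and $$V_{t,q}(\vec{\mathsf{x}})=\prod_{1\le i<j\le m}\frac{\left(q^{j-i-1}t^{\mathsf{x}_i-\mathsf{x}_j-j+i+1};t\right)_\infty}{\left(q^{j-i}t^{\mathsf{x}_i-\mathsf{x}_j-j+i+1};t\right)_\infty}.$$ For $\vec{\mathsf{x}},\vec{\mathsf{y}}\in\mathbb{W}_m$ with $\mathsf{y}_i-\mathsf{x}_i\in\{-1,0\}$ for all $i$, $$\Upsilon_m(\vec{\mathsf{x}},\vec{\mathsf{y}})=t^{-\binom m2}\,\frac{V_{t,q}(\vec{\mathsf{y}})}{V_{t,q}(\vec{\mathsf{x}})}\prod_{\substack{1\le i<j\le m\\ \mathsf{y}_i=\mathsf{x}_i,\ \mathsf{y}_j=\mathsf{x}_j-1}}\omega(\mathsf{x}_i-\mathsf{x}_j,\,j-i)\prod_{i:\,\mathsf{y}_i=\mathsf{x}_i}t^{\mathsf{x}_i}\prod_{i:\,\mathsf{y}_i=\mathsf{x}_i-1}\left(t^{m-i}-q^{m-i}t^{\mathsf{x}_i}\right).$$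 *)

(* Defs.v *)
From mathcomp Require Import all_boot all_order all_algebra.
From mathcomp Require Import all_classical all_reals all_analysis.

Set Implicit Arguments.
Unset Strict Implicit.
Unset Printing Implicit Defensive.

Import Order.TTheory GRing.Theory Num.Theory.
Import numFieldNormedType.Exports.

Local Open Scope classical_set_scope.
Local Open Scope ring_scope.

(* Coordinates are indexed by 'I_m, hence from 0: the coordinate usually
   written x_i with 1 <= i <= m has index i - 1 here. Differences of indices
   are unaffected by the shift, whereas m - i reads m - i.+1. *)

Definition W (m : nat) : set ('I_m -> int) :=
  [set x : 'I_m -> int | (forall i j : 'I_m, (i < j)%N -> x j < x i) /\
                       (forall i : 'I_m, 0 <= x i)].

Definition down_step (m : nat) (x y : 'I_m -> int) : Prop :=
  forall i : 'I_m, y i - x i = -1 \/ y i - x i = 0.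

(* For arbitrary integers a and b, hence with integer powers (exprz). *)
Definition omega (R : realType) (t q : R) (a b : int) : R :=
  ((1 - t ^ (a - b + 1) * q ^ (b - 1)) * (1 - t ^ (a - b) * q ^ (b + 1))) /
  ((1 - t ^ (a - b + 1) * q ^ b) * (1 - t ^ (a - b) * q ^ b)).

(* The infinite product is the limit of its partial products; it is meaningful
   for `|p| < 1. *)
Definition qpochhammer_inf (R : realType) (z p : R) : R :=
  limn (fun n : nat => \prod_(0 <= i < n) (1 - z * p ^+ i)).

Definition V (R : realType) (t q : R) (m : nat) (x : 'I_m -> int) : R :=
  \prod_(i < m) \prod_(j < m | (i < j)%N)
    (qpochhammer_inf
       (q ^ (j%:Z - i%:Z - 1) * t ^ (x i - x j - j%:Z + i%:Z + 1)) t /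
     qpochhammer_inf
       (q ^ (j%:Z - i%:Z) * t ^ (x i - x j - j%:Z + i%:Z + 1)) t).

(* Relevant only for x, y in W m with down_step x y. *)
Definition Upsilon (R : realType) (t q : R) (m : nat) (x y : 'I_m -> int) : R :=
  t ^- 'C(m, 2) * (V t q y / V t q x) *
  (\prod_(i < m) \prod_(j < m | [&& (i < j)%N, y i == x i & y j == x j - 1])
     omega t q (x i - x j) (j%:Z - i%:Z)) *
  (\prod_(i < m | y i == x i) t ^ x i) *
  (\prod_(i < m | y i == x i - 1)
     (t ^+ (m - i.+1) - q ^+ (m - i.+1) * t ^ x i)).

(* Main.v *)
Require Import Defs.
From mathcomp Require Import all_boot all_order all_algebra.
From mathcomp Require Import all_classical all_reals all_analysis.
From mathcomp Require Import ring lra zify.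

Import Order.TTheory GRing.Theory Num.Theory.
Import numFieldNormedType.Exports.

Local Open Scope classical_set_scope.
Local Open Scope ring_scope.

(** Both routes x -> y -> z and x -> w -> z carry the constant [t ^- 'C(m, 2)]
twice, and the ratios of [V] telescope to V(z) / V(x) along either; what
remains is a quotient of local weights, one per pair i < j ([pair_weight]) and
one per coordinate ([row_weight]).

The intermediate states y and w differ only at k.  Hence a weight that does not
involve k is the same along both routes, and cancels.  At k, the route through
y first keeps x_k and then lowers it, while the route through w does the
reverse.  The coordinate weights at k then contribute t ^ x_k against
t ^ (x_k - 1), the lowering weight being common: this is the factor t.  A pair
(i, k) is weighted only in a step which lowers k, and a pair (k, j) only in a
step which keeps k, so each route meets the pairs (i, k) in one of its steps and
the pairs (k, j) in the other; these are the two products.  [UpsilonE] separates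
the weights according to whether k occurs in them.

Cancelling requires every factor to be nonzero, and this is where the geometry
of [W] enters: gaps satisfy x_i - x_j >= j - i ([W_gap]) and x_i >= m - 1 - i
in indices from 0 ([W_ge]), so that every 1 - t ^ a * q ^ b at hand has
nonnegative exponents which do not both vanish.  For [V] one needs in addition
that an infinite product (z; p) with 0 <= z < 1 does not vanish
([qpochhammer_inf_gt0]). *)

(** * Positivity of the infinite product *)

(** This is 1 + v <= e^v at v = u / (1 - u), inverted; enlarging v
to u / (1 - z), linear in u, makes the bound summable over a geometric sequence. *)
Lemma expR_le_1B (R : realType) (z u : R) :
  0 <= u <= z -> z < 1 -> expR (- (u / (1 - z))) <= 1 - u.
Proof.
move=> /andP[u0 uz] z1; rewrite expRN.
have z1' : 0 < 1 - z by rewrite subr_gt0.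
have u1 : 0 < 1 - u by rewrite subr_gt0 (le_lt_trans uz).
have v0 : 0 <= u / (1 - z) by rewrite divr_ge0 // ltW.
rewrite invf_ple ?posrE ?expR_gt0 //.
apply: le_trans (expR_ge1Dx _).
have -> : (1 - u)^-1 = 1 + u / (1 - u) by field; lra.
by rewrite lerD2l ler_wpM2l // lef_pV2 ?posrE // lerD2l lerN2.
Qed.

(** The bound of [expR_le_1B] with u = z p^i sums to a convergent geometric
series, so the decreasing partial products stay above the exponential of minus
its sum. *)
Lemma qpochhammer_inf_gt0 (R : realType) (z p : R) :
  0 <= z < 1 -> 0 < p < 1 -> 0 < qpochhammer_inf z p.
Proof.
move=> /andP[z0 z1] /andP[p0 p1]; rewrite /qpochhammer_inf.
set P := fun n : nat => _.
have pX n : 0 <= p ^+ n <= 1 by rewrite exprn_ge0 ?exprn_ile1 // ltW.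
have uz n : 0 <= z * p ^+ n <= z.
  by have /andP[? ?] := pX n; rewrite mulr_ge0 // ler_piMr.
(* The sum over all i of the exponents z p^i / (1 - z). *)
pose C := z / (1 - z) / (1 - p).
have C0 : 0 <= C by rewrite !divr_ge0 // subr_ge0 ltW.
have PS n : P n.+1 = P n * (1 - z * p ^+ n) by rewrite /P big_nat_recr.
have lbP n : expR (- (C * (1 - p ^+ n))) <= P n.
  elim: n => [|n IHn].
    by rewrite /P big_geq // expr0 subrr mulr0 oppr0 expR0.
  have -> : - (C * (1 - p ^+ n.+1)) =
      - (C * (1 - p ^+ n)) + - (z * p ^+ n / (1 - z)).
    by rewrite /C exprS; field; lra.
  rewrite expRD PS ler_pM ?expR_ge0 //.
  exact: expR_le_1B.
have P0 n : 0 <= P n by apply: le_trans (lbP n); exact: expR_ge0.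
have Pcst n : expR (- C) <= P n.
  apply: le_trans (lbP n); rewrite ler_expR lerN2 ler_piMr //.
  by have /andP[? ?] := pX n; lra.
have Pdecr : {homo P : m n / (m <= n)%N >-> n <= m}.
  apply/nonincreasing_seqP => n.
  by rewrite PS ler_piMr //; have /andP[? ?] := uz n; lra.
have Pcvg : cvgn P.
  by apply: nonincreasing_is_cvgn => //; exists (expR (- C)) => _ [n _ <-].
apply: lt_le_trans (expR_gt0 (- C)) _.
by apply: limr_ge => //; exact: nearW.
Qed.

(** * Nonvanishing on strictly decreasing vectors *)

Lemma exprz_le1 (R : realType) (q : R) (a : int) :
  0 < q < 1 -> 0 <= a -> q ^ a <= 1.
Proof.
move=> /andP[q0 q1]; case: a => // n _.
by rewrite -exprnP exprn_ile1 // ltW.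
Qed.

Lemma exprz_lt1 (R : realType) (q : R) (a : int) :
  0 < q < 1 -> 0 < a -> q ^ a < 1.
Proof.
move=> /andP[q0 q1]; case: a => // n n0.
by rewrite -exprnP exprn_ilt1 // ?ltW // -lt0n.
Qed.

Lemma exprzM_lt1 (R : realType) (t q : R) (a b : int) :
  0 < q < 1 -> 0 < t < 1 -> 0 <= a -> 0 <= b -> 0 < a + b ->
  t ^ a * q ^ b < 1.
Proof.
move=> hq ht a0 b0 ab0.
have [q0 t0] : 0 <= q ^ b /\ 0 <= t ^ a.
  by case/andP: hq => ? _; case/andP: ht => ? _; rewrite !exprz_ge0 ?ltW.
have := a0; rewrite le_eqVlt => /predU1P[a0'|a_gt0].
  by rewrite -a0' expr0z mul1r exprz_lt1 //; move: ab0; rewrite -a0' add0r.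
apply: le_lt_trans (exprz_lt1 _ _ a ht a_gt0).
by rewrite ler_piMr // exprz_le1.
Qed.

Lemma omega_neq0 (R : realType) (t q : R) (a b : int) :
  0 < q < 1 -> 0 < t < 1 -> 1 <= b <= a -> omega t q a b != 0.
Proof.
move=> hq ht hab; rewrite /omega.
have ne (c d : int) : 0 <= c -> 0 <= d -> 0 < c + d -> 1 - t ^ c * q ^ d != 0.
  by move=> *; rewrite subr_eq0 eq_sym lt_eqF // exprzM_lt1.
by rewrite mulf_neq0 ?invr_neq0 // mulf_neq0 //; apply: ne; lia.
Qed.

Lemma W_gap (m : nat) (x : 'I_m -> int) (i j : 'I_m) :
  W x -> (i <= j)%N -> j%:Z - i%:Z <= x i - x j.
Proof.
case=> x_dec _; case: j => j jm /=.
elim: j jm => [|j IHj] jm ij.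
  have -> : i = Ordinal jm by apply/val_inj => /=; lia.
  by rewrite !subrr.
have [->|ij'] := eqVneq i (Ordinal jm); first by rewrite !subrr.
have {}ij : (i <= j)%N by move: ij' ij; rewrite -val_eqE /=; lia.
have := IHj (ltnW jm) ij.
have := x_dec (Ordinal (ltnW jm)) (Ordinal jm) (ltnSn j).
by move=> /=; lia.
Qed.

Lemma W_ge (m : nat) (x : 'I_m -> int) (i : 'I_m) :
  W x -> (m - i.+1)%N%:Z <= x i.
Proof.
move=> Wx.
have lastm : (m.-1 < m)%N by have := ltn_ord i; lia.
have il : (i <= Ordinal lastm)%N by have := ltn_ord i; rewrite /=; lia.
have := W_gap _ _ _ _ Wx il; have [_ /(_ (Ordinal lastm))] := Wx.
by have := ltn_ord i; move=> /=; lia.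
Qed.

Lemma V_neq0 (R : realType) (t q : R) (m : nat) (x : 'I_m -> int) :
  0 < q < 1 -> 0 < t < 1 -> W x -> V t q x != 0.
Proof.
move=> hq ht Wx; apply/prodf_neq0 => i _; apply/prodf_neq0 => j ij.
have gap := W_gap _ _ _ _ Wx (ltnW ij).
have ne (c d : int) : 0 <= c -> 0 < d -> qpochhammer_inf (q ^ c * t ^ d) t != 0.
  move=> c0 d0; rewrite gt_eqF // qpochhammer_inf_gt0 //.
  rewrite exprzM_lt1 ?andbT ?mulr_ge0 ?exprz_ge0 //; try lia.
  - by case/andP: hq => /ltW.
  - by case/andP: ht => /ltW.
by rewrite mulf_neq0 ?invr_neq0 //; apply: ne; lia.
Qed.

(** The weight equals t^n (1 - q^n t^(x_i - n)) with n = m - i.+1, and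
x_i - n > 0 since the lowered coordinate x_i - 1 must still be at least n.  It
does vanish when x_i = n, which is why membership in [W] is asked of the target
of the step. *)
Lemma jump_weight_neq0 (R : realType) (t q : R) (m : nat)
    (x y : 'I_m -> int) (i : 'I_m) :
  0 < q < 1 -> 0 < t < 1 -> W y -> y i = x i - 1 ->
  t ^+ (m - i.+1) - q ^+ (m - i.+1) * t ^ x i != 0.
Proof.
move=> hq ht Wy yi; have := W_ge _ _ i Wy; rewrite yi => xi.
have /andP[t0 _] := ht; have tn0 : t != 0 by rewrite gt_eqF.
set n := (m - i.+1)%N in xi *.
have -> : t ^+ n - q ^+ n * t ^ x i = t ^+ n * (1 - t ^ (x i - n%:Z) * q ^ n%:Z).
  have {1}-> : x i = n%:Z + (x i - n%:Z) by ring.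
  by rewrite expfzDr // -!exprnP; ring.
rewrite mulf_neq0 ?expf_neq0 // subr_eq0 eq_sym lt_eqF // exprzM_lt1 //; lia.
Qed.

(** * Isolating one coordinate *)

Lemma prod_pairs_pivot (R : comRingType) (m : nat) (k : 'I_m)
    (F : 'I_m -> 'I_m -> R) :
  \prod_(i < m) \prod_(j < m | (i < j)%N) F i j =
  (\prod_(i < m | i != k) \prod_(j < m | (i < j)%N && (j != k)) F i j) *
  (\prod_(i < m | (i < k)%N) F i k) * (\prod_(j < m | (k < j)%N) F k j).
Proof.
rewrite (bigD1 k) //= mulrC; congr (_ * _).
have -> : \prod_(i < m | (i < k)%N) F i k =
    \prod_(i < m | i != k) (if (i < k)%N then F i k else 1).
  by rewrite big_mkcond (bigD1 k) //= ltnn mul1r.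
rewrite -big_split /=.
apply: eq_bigr => i _; case: (ltnP i k) => [ik|ki].
  by rewrite (bigD1 k) //= mulrC.
rewrite mulr1; apply: eq_bigl => j; case: eqVneq => [->|_]; last by rewrite andbT.
by rewrite ltnNge ki.
Qed.

(** Local weights are total functions with value 1 off their condition, so that
weights of different steps can be compared factor by factor even though the
conditions select different index sets. *)
Definition pair_weight (R : realType) (t q : R) (m : nat)
    (x y : 'I_m -> int) (i j : 'I_m) : R :=
  if (y i == x i) && (y j == x j - 1)
  then omega t q (x i - x j) (j%:Z - i%:Z) else 1.

Arguments pair_weight {R} t q {m} x y i j.

Definition row_weight (R : realType) (t q : R) (m : nat)
    (x y : 'I_m -> int) (i : 'I_m) : R :=
  (if y i == x i then t ^ x i else 1) *
  (if y i == x i - 1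
   then t ^+ (m - i.+1) - q ^+ (m - i.+1) * t ^ x i else 1).

Arguments row_weight {R} t q {m} x y i.

Lemma UpsilonE (R : realType) (t q : R) (m : nat) (k : 'I_m)
    (x y : 'I_m -> int) :
  Upsilon t q x y =
  t ^- 'C(m, 2) * (V t q y / V t q x) *
  ((\prod_(i < m | i != k) \prod_(j < m | (i < j)%N && (j != k))
      pair_weight t q x y i j) *
   (\prod_(i < m | (i < k)%N) pair_weight t q x y i k) *
   (\prod_(j < m | (k < j)%N) pair_weight t q x y k j)) *
  (row_weight t q x y k *
   \prod_(i < m | i != k) row_weight t q x y i).
Proof.
rewrite /Upsilon -prod_pairs_pivot.
have <- : \prod_(i < m) row_weight t q x y i =
  row_weight t q x y k * \prod_(i < m | i != k) row_weight t q x y i.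
  by rewrite (bigD1 k).
rewrite big_split -!big_mkcond /= !mulrA; do 3!congr (_ * _).
by apply: eq_bigr => i _; rewrite big_mkcondr.
Qed.

Lemma pair_weight_neq0 (R : realType) (t q : R) (m : nat)
    (x y : 'I_m -> int) (i j : 'I_m) :
  0 < q < 1 -> 0 < t < 1 -> W x -> (i < j)%N ->
  pair_weight t q x y i j != 0.
Proof.
move=> hq ht Wx ij; rewrite /pair_weight; case: ifP; last by rewrite oner_neq0.
by move=> _; apply: omega_neq0 => //; have := W_gap _ _ _ _ Wx (ltnW ij); lia.
Qed.

Lemma row_weight_neq0 (R : realType) (t q : R) (m : nat)
    (x y : 'I_m -> int) (i : 'I_m) :
  0 < q < 1 -> 0 < t < 1 -> W y -> row_weight t q x y i != 0.
Proof.
move=> hq ht Wy; rewrite mulf_neq0 //; case: ifP => [|_]; rewrite ?oner_neq0 //.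
  by case/andP: ht => t0 _; rewrite expfz_neq0 // gt_eqF.
by move=> /eqP; exact: jump_weight_neq0.
Qed.

(** * The exchange relation *)

Theorem proposition5p1 (R : realType) (q t : R) (m : nat) (k : 'I_m)
  (x y z w : 'I_m -> int)
  (hq : 0 < q < 1) (ht : 0 < t < 1) (hm : (1 <= m)%N)
  (Wx : W x) (Wy : W y) (Wz : W z) (Ww : W w)
  (hxy : down_step x y) (hyz : down_step y z)
  (hxw : down_step x w) (hwz : down_step w z)
  (hwy : forall i : 'I_m, i != k -> w i = y i)
  (hwk : w k = y k - 1) :
  (Upsilon t q x y * Upsilon t q y z) / (Upsilon t q x w * Upsilon t q w z) =
  t *
  (\prod_(i < m | (i < k)%N)
     (((z i == y i - 1)%:R
       + omega t q (y i - y k) (k%:Z - i%:Z) * (z i == y i)%:R) /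
      ((y i == x i - 1)%:R
       + omega t q (x i - x k) (k%:Z - i%:Z) * (y i == x i)%:R))) *
  (\prod_(j < m | (k < j)%N)
     (((y j == x j)%:R
       + omega t q (x k - x j) (j%:Z - k%:Z) * (y j == x j - 1)%:R) /
      ((z j == y j)%:R
       + omega t q (y k - y j - 1) (j%:Z - k%:Z) * (z j == y j - 1)%:R))).
Proof.
have [ykx zkw] : y k = x k /\ z k = w k.
  by case: (hxy k) (hyz k) (hxw k) (hwz k); lia.
have lt_neq (i : 'I_m) : (i < k)%N -> i != k.
  by move=> /ltn_eqF; rewrite -val_eqE => ->.
have gt_neq (j : 'I_m) : (k < j)%N -> j != k.
  by move=> /gtn_eqF; rewrite -val_eqE => ->.
have t0 : t != 0 by case/andP: ht => ? _; rewrite gt_eqF.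
pose off a b : R := \prod_(i < m | i != k) \prod_(j < m | (i < j)%N && (j != k))
  pair_weight t q a b i j.
pose left_ a b : R := \prod_(i < m | (i < k)%N) pair_weight t q a b i k.
pose right_ a b : R := \prod_(j < m | (k < j)%N) pair_weight t q a b k j.
pose rows a b : R := \prod_(i < m | i != k) row_weight t q a b i.
have off_y : off x w = off x y /\ off w z = off y z.
  split; apply: eq_bigr => i ik; apply: eq_bigr => j /andP[_ jk];
    by rewrite /pair_weight !hwy.
have rows_y : rows x w = rows x y /\ rows w z = rows y z.
  by split; apply: eq_bigr => i ik; rewrite /row_weight !hwy.
(* A pair (i, k) needs a step lowering k, a pair (k, j) a step keeping k. *)
have left1 : left_ x y = 1 /\ left_ w z = 1.
  split; apply: big1 => i _; rewrite /pair_weight.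
    by rewrite ykx; case: ifP => // /andP[_ /eqP]; lia.
  by rewrite zkw; case: ifP => // /andP[_ /eqP]; lia.
have right1 : right_ y z = 1 /\ right_ x w = 1.
  split; apply: big1 => j _; rewrite /pair_weight.
    by rewrite zkw hwk; case: ifP => // /andP[/eqP]; lia.
  by rewrite hwk ykx; case: ifP => // /andP[/eqP]; lia.
have row_xy : row_weight t q x y k = t * t ^ w k.
  rewrite /row_weight ykx eqxx ifF ?mulr1; last by apply/eqP; lia.
  have -> : x k = 1 + w k by rewrite hwk ykx; ring.
  by rewrite expfzDr // expr1z.
have row_wz : row_weight t q w z k = t ^ w k.
  by rewrite /row_weight zkw eqxx ifF ?mulr1 //; apply/eqP; lia.
have row_yz : row_weight t q y z k = row_weight t q x w k.
  by rewrite /row_weight zkw hwk ykx.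
have off_neq0 a b : W a -> off a b != 0.
  move=> Wa; apply/prodf_neq0 => i _; apply/prodf_neq0 => j /andP[ij _].
  exact: pair_weight_neq0.
have rows_neq0 a b : W b -> rows a b != 0.
  by move=> Wb; apply/prodf_neq0 => i _; exact: row_weight_neq0.
have left_neq0 : left_ x w != 0.
  by apply/prodf_neq0 => i ik; exact: pair_weight_neq0.
have right_neq0 : right_ w z != 0.
  by apply/prodf_neq0 => j kj; exact: pair_weight_neq0.
(* Since each step is -1 or 0, exactly one of the two indicators is 1. *)
have indicator_sum (P Q : bool) (o : R) : P = ~~ Q ->
    P%:R + o * Q%:R = if Q then o else 1.
  by move=> ->; case: Q; rewrite /= ?mulr1 ?mulr0 ?add0r ?addr0.
have lowered_iff a b (i : 'I_m) :
    down_step a b -> (b i == a i - 1) = ~~ (b i == a i).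
  by move=> /(_ i) [] step; lia.
have -> : \prod_(i < m | (i < k)%N)
     (((z i == y i - 1)%:R
       + omega t q (y i - y k) (k%:Z - i%:Z) * (z i == y i)%:R) /
      ((y i == x i - 1)%:R
       + omega t q (x i - x k) (k%:Z - i%:Z) * (y i == x i)%:R))
   = left_ y z / left_ x w.
  rewrite -prodf_div; apply: eq_bigr => i /lt_neq ik.
  rewrite !indicator_sum ?lowered_iff // /pair_weight (hwy i ik) zkw hwk ykx eqxx.
  by rewrite !andbT.
have -> : \prod_(j < m | (k < j)%N)
     (((y j == x j)%:R
       + omega t q (x k - x j) (j%:Z - k%:Z) * (y j == x j - 1)%:R) /
      ((z j == y j)%:R
       + omega t q (y k - y j - 1) (j%:Z - k%:Z) * (z j == y j - 1)%:R))
   = right_ x y / right_ w z.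
  rewrite -prodf_div; apply: eq_bigr => j /gt_neq jk.
  rewrite !indicator_sum ?lowered_iff ?negbK // /pair_weight (hwy j jk).
  rewrite zkw hwk ykx !eqxx /=.
  by rewrite !lowered_iff // [x k - 1 - _]addrAC.
rewrite !(UpsilonE R t q m k) -!/(off _ _) -!/(left_ _ _) -!/(right_ _ _).
rewrite -!/(rows _ _) row_xy row_wz row_yz.
rewrite (proj1 off_y) (proj2 off_y) (proj1 rows_y) (proj2 rows_y).
rewrite (proj1 left1) (proj2 left1) (proj1 right1) (proj2 right1).
have := off_neq0 x y Wx; have := off_neq0 y z Wy.
have := rows_neq0 x y Wy; have := rows_neq0 y z Wz.
have := row_weight_neq0 R t q m x w k hq ht Ww.
have := V_neq0 _ _ _ _ _ hq ht Wx; have := V_neq0 _ _ _ _ _ hq ht Wy.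
have := V_neq0 _ _ _ _ _ hq ht Wz; have := V_neq0 _ _ _ _ _ hq ht Ww.
have : t ^+ 'C(m, 2) != 0 by rewrite expf_neq0.
have : t ^ w k != 0 by rewrite expfz_neq0.
move: left_neq0 right_neq0.
by move=> *; field; repeat (apply/andP; split).
Qed.
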